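(* For all $p,q\in\mathbb{N}$ with $n:=p+q\ge 2$, the Clifford algebra $\mathbb{R}_{p,q}$ endowed with the Clifford conjugation satisfies $$\mathcal{R}(\mathbb{R}_{p,q})\le\frac{n^3+5n+6}{6},$$ where $\mathcal{R}(\mathbb{R}_{p,q})$ is the reconstructing number.
   Context: **Clifford algebras.** $\mathbb{N}$ includes $0$. For $n=p+q$, $\mathbb{R}_{p,q}$ is the associative real algebra of dimension $2^n$ with basis $\{e_K\}_{K\in\mathcal{P}(n)}$ ($\mathcal{P}(n)$ is the power set of $\{1,\dots,n\}$), where $e_\varnothing=1$, $e_K=e_{k_1}\cdots e_{k_s}$ for $K=\{k_1<\dots<k_s\}$ (with $e_k:=e_{\{k\}}$), $e_k^2=1$ for $1\le k\le p$, $e_k^2=-1$ for $p+1\le k\le n$, and $e_ke_h=-e_he_k$ for $k\ne h$. The Clifford conjugation is the real linear involution $x\mapsto x^c$ with $e_K^c=e_K$ if $|K|\equiv 0,3\bmod 4$ and $e_K^c=-e_K$ if $|K|\equiv 1,2\bmod 4$. Let $A=\mathbb{R}_{p,q}$ with this involution, and $\mathbb{S}_A:=\{J\in A:J^c=-J,\ J^2=-1\}$. **Slice regular functions.** For $J\in\mathbb{S}_A$ let $\mathbb{C}_J:=\{\alpha+\beta J:\alpha,\beta\in\mathbb{R}\}$, and let $Q_A:=\bigcup_{J\in\mathbb{S}_A}\mathbb{C}_J$. For $D\subset\mathbb{C}$ non-empty, open and invariant under complex conjugation, let $\Omega_D:=\{\alpha+\beta J:\alpha,\beta\in\mathbb{R},\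 \alpha+i\beta\in D,\ J\in\mathbb{S}_A\}\subset Q_A$ (an open circular set). It is a circular slice domain if moreover $D$ is connected and $D\cap\mathbb{R}\ne\varnothing$. A stem function on $D$ is $F=F_1+\iota F_2:D\to A\otimes_{\mathbb{R}}\mathbb{C}$ ($\iota$ the imaginary unit of the second factor, $F_1,F_2:D\to A$) with $F_1(\bar z)=F_1(z)$, $F_2(\bar z)=-F_2(z)$. It induces the slice function $f=\mathcal{I}(F):\Omega_D\to A$, $f(\alpha+\beta J)=F_1(\alpha+i\beta)+JF_2(\alpha+i\beta)$. $f$ is slice regular if $F$ is of class $C^1$ and $\frac{\partial F}{\partial\alpha}+\iota\frac{\partial F}{\partial\beta}=0$. The real components of $f$ are the functions $f_K:\Omega_D\to\mathbb{R}$ with $f=\sum_K f_Ke_K$. **Reconstructing number.** $\mathcal{R}(A)$ is the minimum integer $\ell$ for which there is a subset $\mathcal{K}\subset\mathcal{P}(n)$ of cardinality $\ell$ such that, for each circular slice domain $\Omega\subset Q_A$ and each slice regular $f:\Omega\to A$, if $f_K$ is constant for each $K\in\mathcal{K}$, then $f$ is constant. *)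

(* Defs.v *)
From HB Require Import structures.
From mathcomp Require Import all_boot all_order all_algebra.
From mathcomp Require Import all_classical all_reals all_analysis.

Set Implicit Arguments.
Unset Strict Implicit.
Unset Printing Implicit Defensive.

Import Order.TTheory GRing.Theory Num.Theory.
Import numFieldNormedType.Exports.

Local Open Scope classical_set_scope.
Local Open Scope ring_scope.

Definition symdiff (T : finType) (K L : {set T}) : {set T} :=
  [set x | (x \in K) (+) (x \in L)]%SET.

(* Generators are numbered from 0, so e_k squares to 1 when k < p and to -1
   when p <= k. The factor gen_sign p k l is the sign produced when e_l, coming
   from the right, is moved past (or contracted with) e_k; hence
   e_K e_L = basis_sign p K L e_(K symdiff L). *)
Definition gen_sign (R : comNzRingType) (p n : nat) (k l : 'I_n) : R :=
  if (l < k)%N then -1 else if (k == l) && (p <= k)%N then -1 else 1.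

Definition basis_sign (R : comNzRingType) (p n : nat) (K L : {set 'I_n}) : R :=
  \prod_(k in K) \prod_(l in L) gen_sign R p k l.

(* x stands for \sum_K x_K e_K, with x_K written ecoord x K below. *)
Definition clifford (R : comNzRingType) (p q : nat) : Type :=
  {ffun {set 'I_(p + q)} -> R^o}.

HB.instance Definition _ (R : comNzRingType) (p q : nat) :=
  GRing.Lmodule.copy (clifford R p q) {ffun {set 'I_(p + q)} -> R^o}.

Definition ecoord (R : comNzRingType) (p q : nat) (x : clifford R p q)
    (K : {set 'I_(p + q)}) : R :=
  (x : {ffun {set 'I_(p + q)} -> R^o}) K.

Definition clifford_mk (R : comNzRingType) (p q : nat)
    (c : {set 'I_(p + q)} -> R) : clifford R p q := [ffun K => c K].

Definition clifford_basis (R : comNzRingType) (p q : nat)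
    (K : {set 'I_(p + q)}) : clifford R p q :=
  clifford_mk (fun L => (L == K)%:R).

Definition clifford_one (R : comNzRingType) (p q : nat) : clifford R p q :=
  clifford_basis R finset.set0.

(* The coefficient of e_M in a product collects the pairs (K, L) with
   K symdiff L = M, i.e. L = K symdiff M. *)
Definition clifford_mul (R : comNzRingType) (p q : nat) (x y : clifford R p q) :
    clifford R p q :=
  clifford_mk (fun M => \sum_(K : {set 'I_(p + q)})
    basis_sign R p K (symdiff K M) * (ecoord x K * ecoord y (symdiff K M))).

Section CliffordRing.
Variables (R : comNzRingType) (p q : nat).
Local Notation n := (p + q)%N.
Local Notation A := (clifford R p q).
Local Notation e := (@clifford_basis R p q).
Implicit Types (K L M : {set 'I_n}) (x y z : A).

Lemma symdiffA : associative (@symdiff 'I_n).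
Proof. by move=> K L M; apply/finset.setP => i; rewrite !inE addbA. Qed.

Lemma symdiffC : commutative (@symdiff 'I_n).
Proof. by move=> K L; apply/finset.setP => i; rewrite !inE addbC. Qed.

Lemma symdiffK K : involutive (symdiff K).
Proof. by move=> L; apply/finset.setP => i; rewrite !inE addbA addbb. Qed.

Lemma symdiff0s K : symdiff finset.set0 K = K.
Proof. by apply/finset.setP => i; rewrite !inE. Qed.

Lemma symdiffs0 K : symdiff K finset.set0 = K.
Proof. by rewrite symdiffC symdiff0s. Qed.

Lemma symdiffss K : symdiff K K = finset.set0.
Proof. by apply/finset.setP => i; rewrite !inE addbb. Qed.

Lemma gen_sign_sq (k l : 'I_n) : gen_sign R p k l * gen_sign R p k l = 1.
Proof. by rewrite /gen_sign; do 2?case: ifP => _; rewrite ?mulrNN mulr1. Qed.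

Lemma prod_symdiff (f : 'I_n -> R) K L : (forall i, f i * f i = 1) ->
  \prod_(i in symdiff K L) f i = \prod_(i in K) f i * \prod_(i in L) f i.
Proof.
move=> f2; rewrite big_mkcond /=.
rewrite [X in X * _]big_mkcond [X in _ * X]big_mkcond /=.
rewrite -big_split; apply: eq_bigr => i _; rewrite !inE.
by case: (i \in K); case: (i \in L); rewrite /= ?mulr1 ?mul1r ?f2.
Qed.

Lemma basis_signDr K L M :
  basis_sign R p K (symdiff L M) = basis_sign R p K L * basis_sign R p K M.
Proof.
rewrite -big_split; apply: eq_bigr => k _; apply: prod_symdiff => l.
exact: gen_sign_sq.
Qed.

Lemma basis_signDl K L M :
  basis_sign R p (symdiff K L) M = basis_sign R p K M * basis_sign R p L M.
Proof.
apply: prod_symdiff => i; rewrite -big_split big1 // => l _.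
exact: gen_sign_sq.
Qed.

Lemma basis_sign0l L : basis_sign R p finset.set0 L = 1.
Proof. by rewrite /basis_sign finset.big_set0. Qed.

Lemma basis_sign0r K : basis_sign R p K finset.set0 = 1.
Proof. by rewrite /basis_sign big1 // => k _; rewrite finset.big_set0. Qed.

Lemma clifford_mkE (c : {set 'I_n} -> R) K : ecoord (clifford_mk c) K = c K.
Proof. by rewrite /ecoord ffunE. Qed.

Lemma cliffordP x y : (forall K, ecoord x K = ecoord y K) <-> x = y.
Proof. by split=> [xy|->//]; apply/ffunP => K; exact: xy. Qed.

Lemma ecoordD x y K : ecoord (x + y) K = ecoord x K + ecoord y K.
Proof. by rewrite /ecoord ffunE. Qed.

Lemma ecoordZ a x K : ecoord (a *: x) K = a * ecoord x K.
Proof. by rewrite /ecoord ffunE. Qed.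

Lemma ecoord0 K : ecoord (0 : A) K = 0.
Proof. by rewrite /ecoord ffunE. Qed.

Lemma ecoordN x K : ecoord (- x) K = - ecoord x K.
Proof. by rewrite /ecoord ffunE. Qed.

Lemma ecoord_sum (I : Type) (r : seq I) (P : pred I) (F : I -> A) K :
  ecoord (\sum_(i <- r | P i) F i) K = \sum_(i <- r | P i) ecoord (F i) K.
Proof.
apply: (big_morph (fun x : A => ecoord x K)); last exact: ecoord0.
by move=> x y; exact: ecoordD.
Qed.

Lemma clifford_mulA : associative (@clifford_mul R p q).
Proof.
move=> x y z; apply/cliffordP => M; rewrite !clifford_mkE.
transitivity (\sum_K \sum_I basis_sign R p I (symdiff I M) *
   (basis_sign R p (symdiff I K) (symdiff K M)
    * (ecoord x I * (ecoord y (symdiff I K) * ecoord z (symdiff K M))))).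
  rewrite exchange_big; apply: eq_bigr => I _.
  rewrite clifford_mkE !mulr_sumr (reindex_inj (inv_inj (symdiffK I))) /=.
  apply: eq_bigr => K _.
  have -> : symdiff (symdiff I K) (symdiff I M) = symdiff K M.
    by rewrite (symdiffC I K) -symdiffA symdiffK.
  by rewrite [ecoord x I * _]mulrCA.
apply: eq_bigr => K _; rewrite clifford_mkE mulr_suml mulr_sumr.
apply: eq_bigr => I _; rewrite !mulrA; do 3 congr (_ * _).
rewrite basis_signDl mulrA -basis_signDr mulrC; congr (_ * _).
by congr basis_sign; apply/finset.setP => i; rewrite !inE addbACA addbb addbF.
Qed.

Lemma clifford_mul1x : left_id (clifford_one R p q) (@clifford_mul R p q).
Proof.
move=> x; apply/cliffordP => M; rewrite clifford_mkE (bigD1 finset.set0) //=.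
rewrite big1 ?addr0 => [|K /negPf K0]; last first.
  by rewrite clifford_mkE K0 mul0r mulr0.
by rewrite clifford_mkE eqxx basis_sign0l !mul1r symdiff0s.
Qed.

Lemma clifford_mulx1 : right_id (clifford_one R p q) (@clifford_mul R p q).
Proof.
move=> x; apply/cliffordP => M; rewrite clifford_mkE (bigD1 M) //=.
rewrite big1 ?addr0 => [|K KM]; last first.
  rewrite clifford_mkE (_ : (_ == _) = false) ?mulr0 //.
  apply: contraNF KM => /eqP KM0.
  by rewrite -[M](symdiffK K) KM0 symdiffs0.
by rewrite clifford_mkE symdiffss eqxx basis_sign0r mul1r mulr1.
Qed.

Lemma clifford_mulDl : left_distributive (@clifford_mul R p q) +%R.
Proof.
move=> x y z; apply/cliffordP => M; rewrite ecoordD !clifford_mkE -big_split.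
by apply: eq_bigr => K _; rewrite ecoordD mulrDl mulrDr.
Qed.

Lemma clifford_mulDr : right_distributive (@clifford_mul R p q) +%R.
Proof.
move=> x y z; apply/cliffordP => M; rewrite ecoordD !clifford_mkE -big_split.
by apply: eq_bigr => K _; rewrite ecoordD !mulrDr.
Qed.

Lemma clifford_one_neq0 : clifford_one R p q != 0.
Proof.
apply/eqP => /cliffordP/(_ finset.set0); rewrite clifford_mkE eqxx ecoord0.
by move/eqP; rewrite oner_eq0.
Qed.

HB.instance Definition _ := GRing.Zmodule_isNzRing.Build (clifford R p q)
  clifford_mulA clifford_mul1x clifford_mulx1 clifford_mulDl clifford_mulDr
  clifford_one_neq0.

Lemma clifford_scaleAl (a : R) x y : a *: (x * y) = (a *: x) * y.
Proof.
apply/cliffordP => M; rewrite ecoordZ !clifford_mkE mulr_sumr.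
by apply: eq_bigr => K _; rewrite ecoordZ -mulrA mulrCA.
Qed.

HB.instance Definition _ :=
  GRing.Lmodule_isLalgebra.Build R (clifford R p q) clifford_scaleAl.

Lemma clifford_scaleAr (a : R) x y : a *: (x * y) = x * (a *: y).
Proof.
apply/cliffordP => M; rewrite ecoordZ !clifford_mkE mulr_sumr.
by apply: eq_bigr => K _; rewrite ecoordZ [a * _]mulrCA [a * _]mulrCA.
Qed.

HB.instance Definition _ :=
  GRing.Lalgebra_isAlgebra.Build R (clifford R p q) clifford_scaleAr.

Lemma clifford_basis_expand x : x = \sum_K ecoord x K *: e K.
Proof.
apply/cliffordP => L; rewrite ecoord_sum (bigD1 L) //= big1 => [|K KL].
  by rewrite ecoordZ clifford_mkE eqxx mulr1 addr0.
by rewrite ecoordZ clifford_mkE eq_sym (negPf KL) mulr0.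
Qed.

Lemma clifford_basis_free (a : {set 'I_n} -> R) :
  \sum_K a K *: e K = 0 -> forall K, a K = 0.
Proof.
move=> a0 L; rewrite -(ecoord0 L) -a0 ecoord_sum (bigD1 L) //=.
rewrite big1 => [|K KL]; first by rewrite ecoordZ clifford_mkE eqxx mulr1 addr0.
by rewrite ecoordZ clifford_mkE eq_sym (negPf KL) mulr0.
Qed.

Lemma clifford_basis0 : e finset.set0 = 1. Proof. by []. Qed.

Lemma clifford_basisM K L : e K * e L = basis_sign R p K L *: e (symdiff K L).
Proof.
apply/cliffordP => M; rewrite ecoordZ !clifford_mkE (bigD1 K) //= big1 ?addr0.
  rewrite !clifford_mkE eqxx mul1r.
  have -> : (symdiff K M == L) = (M == symdiff K L).
    by apply/eqP/eqP => [<-|->]; rewrite symdiffK.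
  by case: eqP => [->|]; rewrite ?symdiffK ?mulr0.
by move=> J JK; rewrite !clifford_mkE (negPf JK) mul0r mulr0.
Qed.

Lemma basis_sign1 (k l : 'I_n) :
  basis_sign R p [set k]%SET [set l]%SET = gen_sign R p k l.
Proof. by rewrite /basis_sign !finset.big_set1. Qed.

Lemma clifford_gen_sq (k : 'I_n) :
  e [set k]%SET * e [set k]%SET = if (k < p)%N then 1 else -1.
Proof.
rewrite clifford_basisM symdiffss basis_sign1 /gen_sign ltnn eqxx /= leqNgt.
by case: (k < p)%N; rewrite ?scaleN1r ?scale1r clifford_basis0.
Qed.

Lemma clifford_gen_anticomm (k h : 'I_n) : k != h ->
  e [set k]%SET * e [set h]%SET = - (e [set h]%SET * e [set k]%SET).
Proof.
move=> kh; rewrite !clifford_basisM symdiffC !basis_sign1 /gen_sign.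
rewrite (eq_sym h) (negPf kh) /=.
case: ltngtP (kh) => [_|_|/val_inj kh'] _; rewrite ?scale1r ?scaleN1r ?opprK //.
by rewrite kh' eqxx in kh.
Qed.

(* The product is in increasing order of the index k. *)
Lemma clifford_basis_prod K : e K = \prod_(k in K) e [set k]%SET.
Proof.
pose lt_ord (i j : 'I_n) := (i < j)%N.
have lt_tr : transitive lt_ord by move=> j i k; exact: ltn_trans.
suff H (s : seq 'I_n) : sorted lt_ord s ->
    \prod_(k <- s) e [set k]%SET = e [set k in s]%SET.
  rewrite -big_filter H.
    congr e; apply/finset.setP => k.
    by rewrite inE mem_filter mem_index_enum andbT.
  apply: sorted_filter => //; rewrite /index_enum -enumT.
  have := iota_ltn_sorted 0 n; by rewrite -val_enum_ord sorted_map.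
elim: s => [|k s IH] ks.
  by rewrite big_nil -clifford_basis0; congr e.
have lt_s l : l \in s -> (k < l)%N.
  by move: ks; rewrite /= path_sortedE // => /andP[/allP H _]; exact: H.
rewrite big_cons IH ?(path_sorted ks) // clifford_basisM.
rewrite /basis_sign finset.big_set1 big1 => [|l]; last first.
  rewrite inE => /lt_s kl; rewrite /gen_sign ltnNge (ltnW kl) /=.
  by case: eqP kl => // ->; rewrite ltnn.
rewrite scale1r; congr e; apply/finset.setP => i; rewrite !inE.
by case: eqP => // ->; case: (boolP (k \in s)) => // /lt_s; rewrite ltnn.
Qed.

End CliffordRing.

Section Slice.
Variables (R : realType) (p q : nat).
Local Notation A := (clifford R p q).

Definition clifford_conj (x : A) : A :=
  clifford_mk (fun K => if (#|K| %% 4 == 1)%N || (#|K| %% 4 == 2)%N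
                        then - ecoord x K else ecoord x K).

Definition imaginary_units : set A :=
  [set J | clifford_conj J = - J /\ J ^+ 2 = -1].

Definition complex_slice (J : A) : set A :=
  [set x : A | exists a b : R, x = a%:A + b *: J].

Definition quadratic_cone : set A :=
  \bigcup_(J in imaginary_units) complex_slice J.

(* The complex plane is R * R, the point (a, b) standing for a + ib. *)
Definition circularization (D : set (R * R)) : set A :=
  [set x : A | exists a b J,
     [/\ D (a, b), imaginary_units J & x = a%:A + b *: J]].

Lemma circularization_sub D : circularization D `<=` quadratic_cone.
Proof. by move=> _ [a [b [J [_ SJ ->]]]]; exists J => //; exists a, b. Qed.

Definition complex_conj (z : R * R) : R * R := (z.1, - z.2).

Definition circular_domain (D : set (R * R)) : Prop :=
  [/\ D !=set0, open D & forall z, D z -> D (complex_conj z)].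

Definition circular_slice_domain (D : set (R * R)) : Prop :=
  [/\ circular_domain D, connected D & exists a, D (a, 0)].

(* A (x) C is A * A, the pair (x1, x2) standing for x1 + iota x2. *)
Definition iota_mul (w : A * A) : A * A := (- w.2, w.1).

Definition stem_function (D : set (R * R)) (F : R * R -> A * A) : Prop :=
  forall z, D z -> (F (complex_conj z)).1 = (F z).1 /\
                   (F (complex_conj z)).2 = - (F z).2.

(* Real-valued functions of class C^1 on an open subset of the plane. *)
Definition C1_on (D : set (R * R)) (g : R * R -> R) : Prop :=
  forall v, v = (1, 0) \/ v = (0, 1) -> forall z, D z ->
    derivable g z v /\ {for z, continuous (fun w => 'D_v g w)}.

(* Class C^1 for maps into the finite-dimensional space A * A is taken
   coordinatewise, and so are their directional derivatives. *)
Definition stem_C1_on (D : set (R * R)) (F : R * R -> A * A) : Prop :=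
  forall K, C1_on D (fun z => ecoord (F z).1 K) /\
            C1_on D (fun z => ecoord (F z).2 K).

Definition stem_derive (F : R * R -> A * A) (v z : R * R) : A * A :=
  (clifford_mk (fun K => 'D_v (fun w => ecoord (F w).1 K) z),
   clifford_mk (fun K => 'D_v (fun w => ecoord (F w).2 K) z)).

Definition holomorphic_stem (D : set (R * R)) (F : R * R -> A * A) : Prop :=
  stem_C1_on D F /\
  forall z, D z ->
    stem_derive F (1, 0) z + iota_mul (stem_derive F (0, 1) z) = 0.

Definition induces (D : set (R * R)) (F : R * R -> A * A) (f : A -> A) : Prop :=
  forall a b J, D (a, b) -> imaginary_units J ->
    f (a%:A + b *: J) = (F (a, b)).1 + J * (F (a, b)).2.

(* Only the values of f on circularization D matter. *)
Definition slice_regular (D : set (R * R)) (f : A -> A) : Prop :=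
  exists F, [/\ stem_function D F, holomorphic_stem D F & induces D F f].

Definition constant_on (T U : Type) (X : set T) (f : T -> U) : Prop :=
  exists c, forall x, X x -> f x = c.

Definition reconstructing (KK : {set {set 'I_(p + q)}}) : Prop :=
  forall (D : set (R * R)) (f : A -> A),
    circular_slice_domain D -> slice_regular D f ->
    (forall K, K \in KK ->
       constant_on (circularization D) (fun x => ecoord (f x) K)) ->
    constant_on (circularization D) f.

Lemma reconstructing_setT : reconstructing finset.setT.
Proof.
move=> D f _ _ fK; pose c K := projT1 (cid (fK K (finset.in_setT K))).
exists (clifford_mk c) => x Dx; apply/cliffordP => K; rewrite clifford_mkE.
by rewrite /c; case: cid => /= cK; exact.
Qed.

Lemma reconstructing_card_ex :
  exists l, `[< exists KK : {set {set 'I_(p + q)}},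
                  #|KK| = l /\ reconstructing KK >].
Proof.
exists #|[set: {set 'I_(p + q)}]%SET|; apply/asboolP; exists [set: _]%SET.
by split => //; exact: reconstructing_setT.
Qed.

Definition reconstructing_number : nat := ex_minn reconstructing_card_ex.

End Slice.

(* Main.v *)
Require Import Defs.
From mathcomp Require Import all_boot all_order all_algebra.
From mathcomp Require Import all_classical all_reals all_analysis.
From mathcomp Require Import zify ring lra.

Set Implicit Arguments.
Unset Strict Implicit.
Unset Printing Implicit Defensive.

Import Order.TTheory GRing.Theory Num.Theory.
Import numFieldNormedType.Exports.

Local Open Scope classical_set_scope.
Local Open Scope ring_scope.

(** Write f = I(F) with F = F_1 + iota F_2, and let KK be the family of the
sets K with at most three elements; it has
1 + n + C(n, 2) + C(n, 3) = (n^3 + 5n + 6) / 6 members, so it is enough that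
KK is reconstructing.

Let f_K be constant for every K in KK.  Comparing the values of f at
a + bJ and at a - bJ shows that (F_1)_K is constant and that (J F_2)_K
vanishes on D for every imaginary unit J.  The second condition is linear
in J, so it holds for every J in the span of the imaginary units.  This span
contains e_H as soon as |H| = 2 mod 4 ([basis_in_span_imaginary_units]):
either e_H^2 = -1, or some generator e_k with k in H has square -1 and
anticommutes with e_H, and then hyperbolic combinations of e_H and e_k are
imaginary units.  As e_H permutes the coordinates up to sign, (F_2)_L = 0
whenever L is the symmetric difference of H and K.

If |L| >= 2, removing from L a subset K of |L| - 2 mod 4 elements leaves such
an H, and K has at most three elements; hence (F_2)_L = 0.  If |L| <= 3, then
L is in KK, (F_1)_L is constant, and by the Cauchy-Riemann equations (F_2)_L
is constant on the connected set D ([CR_constant]); it vanishes at a real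
point, because F_2 is odd under conjugation.  So F_2 = 0, whence F_1 is
constant by the Cauchy-Riemann equations again, and so is f. *)

(** * Functions on a plane domain with vanishing partial derivatives *)

Lemma is_derive_along_line (R : realType) (V : normedModType R) (g : V -> R)
    (v z : V) (t df : R) :
  is_derive (t *: v + z) v g df -> is_derive t 1 (fun s => g (s *: v + z)) df.
Proof.
have E : (fun h => h^-1 *: (((fun s => g (s *: v + z)) \o shift t) (h *: 1)
                             - g (t *: v + z)))
       = (fun h => h^-1 *: ((g \o shift (t *: v + z)) (h *: v)
                             - g (t *: v + z))) :> (R -> R).
  by apply/funext => h /=; rewrite [h *: 1]mulr1 scalerDl addrA.
by case=> dg <-; split; rewrite ?/derivable ?/derive E.
Qed.

Lemma segment_constant (R : realType) (V : normedModType R) (g : V -> R)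
    (v z : V) (a b : R) : a <= b ->
  (forall t, t \in `[a, b] -> is_derive (t *: v + z) v g 0) ->
  g (a *: v + z) = g (b *: v + z).
Proof.
move=> ab dg.
have dphi t : t \in `[a, b] -> is_derive t 1 (fun s => g (s *: v + z)) 0.
  by move/dg; exact: is_derive_along_line.
pose phi (s : R) : R := g (s *: v + z).
have phi_cont : {within `[a, b], continuous phi}.
  by apply: derivable_within_continuous => t /dphi[].
have phi_der t : t \in `]a, b[ -> is_derive t 1 phi (cst 0 t).
  move=> tab; apply: dphi; move: tab.
  by rewrite !in_itv /= => /andP[/ltW-> /ltW->].
have [c _ /eqP] := MVT_segment ab phi_der phi_cont.
by rewrite mul0r subr_eq0 eq_sym => /eqP.
Qed.

(** The orientation-free form spares a case distinction on the relative position
of the corners of a box. *)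
Lemma segment_constantW (R : realType) (V : normedModType R) (g : V -> R)
    (v z : V) (a b : R) :
  (forall t, Num.min a b <= t <= Num.max a b -> is_derive (t *: v + z) v g 0) ->
  g (a *: v + z) = g (b *: v + z).
Proof.
case: (leP a b) => [|/ltW] ab dg; last symmetry.
  by apply: segment_constant => // t; rewrite in_itv; exact: dg.
by apply: segment_constant => // t; rewrite in_itv; exact: dg.
Qed.

Lemma between_ball (R : realType) (a b t e : R) :
  ball a e b -> Num.min a b <= t <= Num.max a b -> ball a e t.
Proof.
rewrite /ball /= !ltr_norml; case: (leP a b) => ab /andP[? ?] /andP[? ?].
  by apply/andP; split; lra.
by apply/andP; split; lra.
Qed.

(** Balls of the product are squares, so a horizontal segment followed by a
vertical one joins the centre to any point without leaving the ball. *)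
Lemma box_constant (R : realType) (g : R * R -> R) (z w : R * R) (e : R) :
  (forall x, ball z e x -> is_derive x (1, 0) g 0) ->
  (forall x, ball z e x -> is_derive x (0, 1) g 0) ->
  ball z e w -> g w = g z.
Proof.
case: z w => [a b] [c d] dx dy [/= ac bd].
have hor (t y : R) : t *: (1, 0) + (0, y) = (t, y) :> R * R.
  by congr pair => /=; rewrite ?scaler0 ?add0r // addr0 [_ *: _]mulr1.
have ver (t x : R) : t *: (0, 1) + (x, 0) = (x, t) :> R * R.
  by congr pair => /=; rewrite ?scaler0 ?add0r // addr0 [_ *: _]mulr1.
have e0 : 0 < e by exact: le_lt_trans (normr_ge0 _) ac.
transitivity (g (c, b)).
  rewrite -(ver d) -(ver b c); symmetry.
  apply: segment_constantW => t tbd; rewrite ver.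
  by apply: dy; split => //; exact: between_ball bd tbd.
rewrite -(hor c) -(hor a b); symmetry.
apply: segment_constantW => t tac; rewrite hor.
by apply: dx; split; [exact: between_ball ac tac|exact: ballxx].
Qed.

(** Every union of fibres is relatively open, so a single fibre is relatively
clopen. *)
Lemma locally_constant_connected (T : topologicalType) (U : Type) (D : set T)
    (g : T -> U) : open D -> connected D ->
  (forall z, D z -> \forall w \near z, g w = g z) ->
  forall z w, D z -> D w -> g w = g z.
Proof.
move=> oD cD gD z w Dz Dw.
have fibre_open (P : U -> Prop) : open (D `&` [set x | P (g x)]).
  rewrite openE => x [Dx Px]; apply: filterI; first exact: open_nbhs_nbhs.
  by move: (gD x Dx); apply: filterS => y; rewrite /= => ->.
suff DE : D `&` [set x | g x = g z] = D by move: Dw; rewrite -DE => -[].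
apply: cD; first by exists z.
  exists (D `&` [set x | g x = g z]); first exact: (fibre_open (eq^~ (g z))).
  by rewrite setIA setIid.
exists (~` (D `&` [set x | g x <> g z])).
  exact/open_closedC/(fibre_open (fun u => u <> g z)).
apply/seteqP; split=> x /= [Dx gx]; split=> //; first by case.
by apply: contrapT => gxz; apply: gx.
Qed.

Lemma zero_partials_constant (R : realType) (D : set (R * R)) (g : R * R -> R) :
  open D -> connected D ->
  (forall x, D x -> is_derive x (1, 0) g 0) ->
  (forall x, D x -> is_derive x (0, 1) g 0) ->
  forall z w, D z -> D w -> g w = g z.
Proof.
move=> oD cD dx dy; apply: locally_constant_connected => // z Dz.
have /nbhs_ballP[e e0 zD] := open_nbhs_nbhs (conj oD Dz).
apply/nbhs_ballP; exists e => // w zw.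
by apply: (box_constant (e := e)) zw => x /zD; [exact: dx|exact: dy].
Qed.

Lemma derive_eq0_on_open (R : realType) (D : set (R * R)) (g : R * R -> R) c :
  open D -> (forall w, D w -> g w = c) ->
  forall v z, D z -> 'D_v g z = 0.
Proof.
move=> oD gc v z Dz; have <- : 'D_v (cst c) z = 0 by exact: derive_cst.
apply: near_eq_derive.
have := open_nbhs_nbhs (conj oD Dz); apply: filterS => w /= Dw; exact: gc.
Qed.

(** The coefficients a and b carry the signs of the Cauchy-Riemann equations, so
that either component of a holomorphic stem function may play the role of u. *)
Lemma CR_constant (R : realType) (D : set (R * R)) (u v : R * R -> R)
    (a b c : R) : open D -> connected D -> C1_on D v ->
  (forall z, D z -> 'D_(1, 0) v z = a * 'D_(0, 1) u z) ->
  (forall z, D z -> 'D_(0, 1) v z = b * 'D_(1, 0) u z) ->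
  (forall z, D z -> u z = c) ->
  forall z w, D z -> D w -> v w = v z.
Proof.
move=> oD cD vC1 vx vy uc.
apply: zero_partials_constant => // z Dz; split.
- by have [] := vC1 (1, 0) (or_introl erefl) z Dz.
- by rewrite vx // (derive_eq0_on_open oD uc) ?mulr0.
- by have [] := vC1 (0, 1) (or_intror erefl) z Dz.
- by rewrite vy // (derive_eq0_on_open oD uc) ?mulr0.
Qed.

(** * Signs of products of basis elements *)

Section Units.
Variables (R : realType) (p q : nat).
Local Notation n := (p + q)%N.
Local Notation A := (clifford R p q).
Local Notation e := (@clifford_basis R p q).
Local Notation s := (basis_sign R p).
Implicit Types (H K L : {set 'I_n}) (k l : 'I_n).

Lemma basis_sign_sq K L : s K L * s K L = 1.
Proof.
rewrite -big_split big1 // => k _; rewrite -big_split big1 // => l _.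
exact: gen_sign_sq.
Qed.

Lemma gen_sign_swap k l :
  gen_sign R p k l * gen_sign R p l k = (-1) ^+ (k != l).
Proof.
case: eqVneq => [->|kl]; first by rewrite gen_sign_sq.
rewrite /gen_sign (eq_sym l) (negPf kl) /=.
by case: ltngtP kl => [_|_|/val_inj->]; rewrite ?mulr1 ?mul1r ?eqxx.
Qed.

Lemma basis_sign_swap k K :
  s [set k]%SET K * s K [set k]%SET = (-1) ^+ #|K :\ k|.
Proof.
rewrite /basis_sign finset.big_set1 -big_split /=.
transitivity (\prod_(l in K) (-1) ^+ (k != l) : R).
  by apply: eq_bigr => l _; rewrite finset.big_set1 gen_sign_swap.
rewrite prodrXr -sum1_card big_mkcond [in RHS]big_mkcond /=; congr (_ ^+ _).
by apply: eq_bigr => l _; rewrite !inE eq_sym; case: (l \in K); case: eqP.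
Qed.

(** Squaring e_H moves each pair of distinct generators past one another once
and contracts each generator with itself. *)
Lemma basis_sign_diag H :
  s H H = (-1) ^+ 'C(#|H|, 2) * \prod_(k in H) gen_sign R p k k.
Proof.
have [m] := ubnP #|H|; elim: m H => // m IH H.
have [->|[k kH] Hm] := set_0Vmem H.
  by rewrite cards0 !finset.big_set0 mul1r /basis_sign finset.big_set0.
have HE : H = symdiff [set k]%SET (H :\ k).
  apply/finset.setP => i; rewrite !inE.
  by case: eqP => [->|] /=; rewrite ?kH.
have Hk : #|H| = #|H :\ k|.+1 by rewrite (cardsD1 k H) kH.
rewrite {1 2}HE basis_signDl !basis_signDr basis_sign1 IH; last by lia.
rewrite (finset.big_setD1 k kH) /= Hk binS bin1 exprD.
have -> : (-1) ^+ #|H :\ k| = s [set k]%SET (H :\ k) * s (H :\ k) [set k]%SET.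
  rewrite basis_sign_swap; congr (_ ^+ _).
  by apply: eq_card => i; rewrite !inE; case: eqP.
ring.
Qed.

Lemma clifford_basis_sq H : e H * e H = s H H *: 1.
Proof. by rewrite clifford_basisM symdiffss clifford_basis0. Qed.

Lemma clifford_basis_anticomm k H : k \in H -> ~~ odd #|H| ->
  e [set k]%SET * e H = - (e H * e [set k]%SET).
Proof.
move=> kH evH; rewrite !clifford_basisM symdiffC -scaleNr; congr (_ *: _).
have /(congr1 (fun x => x * s H [set k]%SET)) := basis_sign_swap k H.
rewrite -mulrA basis_sign_sq mulr1 => ->.
have : odd #|H :\ k| by move: evH; rewrite (cardsD1 k H) kH /= negbK.
by move=> o; rewrite -signr_odd o mulN1r.
Qed.

(** * Imaginary units *)

Lemma clifford_conj_antisym (x : A) :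
  (forall K, ecoord x K != 0 -> (#|K| %% 4 == 1)%N || (#|K| %% 4 == 2)%N) ->
  clifford_conj x = - x.
Proof.
move=> xP; apply/cliffordP => K; rewrite clifford_mkE ecoordN.
case: ifP => // /negP nK; have [->|/xP //] := eqVneq (ecoord x K) 0.
by rewrite oppr0.
Qed.

Lemma imaginary_unitN (J : A) : imaginary_units J -> imaginary_units (- J).
Proof.
case=> cJ J2; split; last by rewrite sqrrN.
rewrite opprK; apply/cliffordP => K; move/cliffordP/(_ K): cJ.
rewrite [ecoord (- J) K]ecoordN [ecoord (clifford_conj J) K]clifford_mkE.
rewrite clifford_mkE ecoordN opprK.
by case: ifP => _ // ->; rewrite opprK.
Qed.

(** When e_H squares to 1, the sign formula forces a generator e_k of negative
square in H; it anticommutes with e_H because |H| is even.  Then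
(a e_H + b e_k)^2 = a^2 - b^2, and the 3-4-5 triangle gives a solution of
a^2 - b^2 = -1 without square roots. *)
Lemma basis_in_span_imaginary_units H : (#|H| %% 4 == 2)%N ->
  exists J1 J2 : A, exists a b : R,
    [/\ imaginary_units J1, imaginary_units J2 & e H = a *: J1 + b *: J2].
Proof.
move=> H2.
have H_imag : e H ^+ 2 = -1 ->
    exists J1 J2 : A, exists a b : R,
    [/\ imaginary_units J1, imaginary_units J2 & e H = a *: J1 + b *: J2].
  move=> eH2; suff iH : imaginary_units (e H).
    by exists (e H), (e H), 1, 0; rewrite scale1r scale0r addr0.
  split=> //; apply: clifford_conj_antisym => K.
  by rewrite clifford_mkE; case: (eqVneq K H) => [->|]; rewrite ?H2 ?orbT ?eqxx.
have evH : ~~ odd #|H| by lia.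
have [/existsP[k /andP[kH pk]]|/existsPn noneg] :=
    boolP [exists k, (k \in H) && (p <= k)%N]; last first.
  apply: H_imag; rewrite expr2 clifford_basis_sq basis_sign_diag big1.
    (* |H| = 4m + 2 makes C(|H|, 2) = (2m + 1)(4m + 1) odd. *)
    have [m Hm] : exists m, #|H| = (m * 4 + 2)%N.
      by exists (#|H| %/ 4)%N; rewrite {1}(divn_eq #|H| 4) (eqP H2).
    have -> : 'C(#|H|, 2) = (((2 * m + 1) * (2 * m)).*2 + (2 * m).+1)%N.
      by rewrite Hm bin2; nia.
    by rewrite mulr1 -signr_odd oddD odd_double /= oddM scaleN1r.
  move=> k kH; move: (noneg k); rewrite kH /= -ltnNge => kp.
  by rewrite /gen_sign ltnn eqxx leqNgt kp.
have : (s H H - 1) * (s H H + 1) = 0.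
  by rewrite -subr_sqr expr2 basis_sign_sq expr1n subrr.
move/eqP; rewrite mulf_eq0 subr_eq0 addr_eq0 => /orP[] /eqP sH; last first.
  by apply: H_imag; rewrite expr2 clifford_basis_sq sH scaleN1r.
pose f := e [set k]%SET.
have f2 : f * f = -1 by rewrite clifford_gen_sq ltnNge pk.
have H22 : e H * e H = 1 by rewrite clifford_basis_sq sH scale1r.
have fH : f * e H = - (e H * f) by exact: clifford_basis_anticomm.
have kimag : imaginary_units f.
  split=> //; apply: clifford_conj_antisym => K.
  rewrite clifford_mkE.
  by case: (eqVneq K [set k]%SET) => [->|]; rewrite ?cards1 ?eqxx.
exists (3 / 4 *: e H + 5 / 4 *: f), f, (4 / 3), (- (5 / 3)); split=> //.
  split.
    apply: clifford_conj_antisym => K.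
    rewrite ecoordD !ecoordZ !clifford_mkE.
    case: (eqVneq K H) => [->|_]; first by rewrite H2 orbT.
    case: (eqVneq K [set k]%SET) => [->|_]; rewrite ?cards1 //.
    by rewrite !mulr0 addr0 eqxx.
  rewrite expr2 mulrDl !mulrDr -!scalerAl -!scalerAr !scalerA f2 H22 fH.
  rewrite !scalerN [5 / 4 * (3 / 4)]mulrC.
  rewrite addrA addrK -scalerBl.
  by rewrite -[RHS]scaleN1r; congr (_ *: _); lra.
rewrite scalerDr !scalerA -addrA -scalerDl.
have -> : 4 / 3 * (5 / 4) + - (5 / 3) = 0 :> R by lra.
have -> : 4 / 3 * (3 / 4) = 1 :> R by lra.
by rewrite scale0r addr0 scale1r.
Qed.

Lemma ecoord_basis_mul H K (x : A) :
  ecoord (e H * x) K = s H (symdiff H K) * ecoord x (symdiff H K).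
Proof.
rewrite clifford_mkE (bigD1 H) //= big1 ?addr0 => [|L LH].
  by rewrite clifford_mkE eqxx mul1r.
by rewrite clifford_mkE (negPf LH) mul0r mulr0.
Qed.

Lemma ecoord_basis_mul_eq0 H K (x : A) :
  ecoord (e H * x) K = 0 -> ecoord x (symdiff H K) = 0.
Proof.
rewrite ecoord_basis_mul => /(congr1 (fun y => s H (symdiff H K) * y)).
by rewrite mulrA basis_sign_sq mul1r mulr0.
Qed.

End Units.

(** * Sets with at most three elements *)

Lemma card_sets_lt (T : finType) (r : nat) :
  #|[set K : {set T} | (#|K| < r)%N]%SET| = (\sum_(i < r) 'C(#|T|, i))%N.
Proof.
elim: r => [|r IH].
  by rewrite big_ord0; apply: eq_card0 => K; rewrite inE.
rewrite big_ord_recr -IH -card_draws /=.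
rewrite -(cardsID [set K : {set T} | (#|K| < r)%N]%SET); congr addn;
  by apply: eq_card => K; rewrite !inE; lia.
Qed.

Lemma cake_number (R : realFieldType) (m : nat) :
  (m%:R ^+ 3 + 5 * m%:R + 6) / 6 = (\sum_(i < 4) 'C(m, i))%:R :> R.
Proof.
elim: m => [|m IH].
  have -> : (\sum_(i < 4) 'C(0, i) = 1)%N by rewrite !big_ord_recr big_ord0.
  by rewrite mulr0n expr0n mulr0 !add0r divff ?pnatr_eq0.
have -> : (\sum_(i < 4) 'C(m.+1, i)
            = \sum_(i < 4) 'C(m, i) + 1 + m + 'C(m, 2))%N.
  by rewrite !big_ord_recr !big_ord0 /= !binS !bin0 !bin1; lia.
have C2 : (2 * 'C(m, 2) + m = m * m)%N.
  by elim: m {IH} => // m IH; rewrite binS bin1; nia.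
have /(congr1 (fun k => k%:R : R)) := C2; rewrite natrD !natrM => C2R.
by rewrite !natrD -IH -natr1; nra.
Qed.

(** The four sizes 0, ..., 3 of K cover all residues of |L| modulo 4. *)
Lemma residue_subset (T : finType) (L : {set T}) : (2 <= #|L|)%N ->
  exists2 K : {set T}, (#|K| <= 3)%N & K \subset L /\ (#|L :\: K| %% 4 == 2)%N.
Proof.
move=> L2; have mL : ((#|L| - 2) %% 4 <= #|L|)%N by lia.
have /card_geqP[s [us ss sL]] := mL.
have cK : #|[set x in s]%SET| = ((#|L| - 2) %% 4)%N.
  by rewrite cardsE (card_uniqP us).
have sKL : [set x in s]%SET \subset L.
  by apply/fintype.subsetP => x; rewrite inE => /sL.
exists [set x in s]%SET; first by rewrite cK; lia.
by split=> //; rewrite cardsDS // cK; lia.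
Qed.

(** * Reconstruction from few components *)

Section Reconstruction.
Variables (R : realType) (p q : nat).
Local Notation n := (p + q)%N.
Local Notation A := (clifford R p q).
Implicit Types (K L : {set 'I_n}).

Lemma holomorphic_stem_CR (D : set (R * R)) (F : R * R -> A * A) L :
  holomorphic_stem D F -> forall z, D z ->
  'D_(1, 0) (fun w => ecoord (F w).1 L) z
    = 'D_(0, 1) (fun w => ecoord (F w).2 L) z /\
  'D_(0, 1) (fun w => ecoord (F w).1 L) z
    = - 'D_(1, 0) (fun w => ecoord (F w).2 L) z.
Proof.
move=> [_ CR] z /CR CRz.
have := congr1 (fun x => ecoord x.2 L) CRz.
have := congr1 (fun x => ecoord x.1 L) CRz.
rewrite /= !ecoordD ecoordN [ecoord 0 L]ecoord0 !clifford_mkE.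
move=> /eqP + /eqP; rewrite subr_eq0 addr_eq0 => /eqP-> /eqP->.
by rewrite opprK.
Qed.

(** J and -J are both imaginary units, so the values at a + bJ and a - bJ
separate the contributions of F_1 and F_2; J0 only provides a point of the
circularization above each point of D. *)
Lemma constant_component (D : set (R * R)) (F : R * R -> A * A) (f : A -> A)
    K (J0 : A) :
  induces D F f -> imaginary_units J0 ->
  constant_on (circularization D) (fun x => ecoord (f x) K) ->
  exists c, forall z, D z ->
    ecoord (F z).1 K = c /\ forall J : A, imaginary_units J ->
    ecoord (J * (F z).2) K = 0.
Proof.
move=> Ff iJ [c fc]; exists c => -[a b] Dz.
have val J' : imaginary_units J' ->
    ecoord (F (a, b)).1 K + ecoord (J' * (F (a, b)).2) K = c.
  by move=> iJ'; rewrite -ecoordD -Ff // fc //; exists a, b, J'.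
have opp J' : imaginary_units J' -> ecoord (J' * (F (a, b)).2) K = 0.
  move=> iJ'; have := val _ iJ'; have := val _ (imaginary_unitN iJ').
  rewrite mulNr ecoordN => v1 v2; lra.
by split=> [|J' /opp //]; have := val _ iJ; rewrite opp // addr0.
Qed.

Lemma reconstructing_le3 : (2 <= n)%N ->
  @reconstructing R p q [set K : {set 'I_n} | (#|K| <= 3)%N]%SET.
Proof.
move=> n2 D f [[D0 oD symD] cD [r Dr]] [F [Fsym Fhol Ff]] fK.
have spanH H := @basis_in_span_imaginary_units R p q H.
have [J iJ] : exists J : A, imaginary_units J.
  have /card_geqP[s [us ss _]] : (2 <= #|'I_n|)%N by rewrite card_ord.
  have /spanH[J [_ [_ [_ [iJ _ _]]]]] : (#|[set x in s]%SET| %% 4 == 2)%N.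
    by rewrite cardsE (card_uniqP us) ss.
  by exists J.
have comp K : (#|K| <= 3)%N -> exists c, forall z, D z ->
    ecoord (F z).1 K = c /\ forall J : A, imaginary_units J ->
    ecoord (J * (F z).2) K = 0.
  move=> K3; apply: (constant_component Ff iJ); apply: fK.
  by rewrite inE.
have F20 L z : D z -> ecoord (F z).2 L = 0.
  move=> Dz; have [L2|L2] := leqP 2 #|L|.
    have [K /comp[c Fc] [KL /spanH[J1 [J2 [a [b [iJ1 iJ2 eH]]]]]]] :=
      residue_subset L2.
    have [_ JF] := Fc z Dz.
    have -> : L = symdiff (L :\: K) K.
      apply/finset.setP => i; rewrite !inE.
      have := fintype.subsetP KL i.
      by case: (i \in K) => [-> //|_]; rewrite addbF.
    apply: ecoord_basis_mul_eq0; rewrite eH mulrDl -!scalerAl.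
    by rewrite ecoordD !ecoordZ !JF // !mulr0 addr0.
  have /comp[c Fc] : (#|L| <= 3)%N by lia.
  have F1c w : D w -> ecoord (F w).1 L = c by move=> /Fc[].
  have CR := holomorphic_stem_CR L Fhol.
  have C1 : C1_on D (fun w => ecoord (F w).2 L) by case: (Fhol.1 L).
  rewrite (CR_constant (a := -1) (b := 1) oD cD C1 _ _ F1c Dr Dz).
  (* At a real point F_2 equals its own opposite. *)
  - have [_ /(congr1 (fun x => ecoord x L))] := Fsym _ Dr.
    rewrite /complex_conj /= oppr0 ecoordN => ?; lra.
  - by move=> w /CR[_ ->]; rewrite mulN1r opprK.
  - by move=> w /CR[->]; rewrite mul1r.
exists (F (r, 0)).1 => _ [a [b [J' [Dab iJ' ->]]]].
rewrite Ff // (_ : (F (a, b)).2 = 0) ?mulr0 ?addr0; last first.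
  by apply/cliffordP => L; rewrite F20 // [RHS]ecoord0.
apply/cliffordP => L.
have CR := holomorphic_stem_CR L Fhol.
have C1 : C1_on D (fun w => ecoord (F w).1 L) by case: (Fhol.1 L).
apply: (CR_constant (a := 1) (b := -1) oD cD C1 _ _ (F20 L) Dr Dab).
- by move=> w /CR[->]; rewrite mul1r.
- by move=> w /CR[_ ->]; rewrite mulN1r.
Qed.

End Reconstruction.

Theorem theorem1p5 (R : realType) (p q : nat) (hn : (2 <= p + q)%N) :
  (reconstructing_number R p q)%:R
    <= ((p + q)%:R ^+ 3 + 5 * (p + q)%:R + 6) / 6 :> R.
Proof.
rewrite /reconstructing_number; case: ex_minnP => l _ lmin.
set KK := [set K : {set 'I_(p + q)} | (#|K| < 4)%N]%SET.
have lKK : (l <= #|KK|)%N.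
  apply: lmin; apply/asboolP; exists KK; split=> //.
  exact: reconstructing_le3.
by rewrite cake_number ler_nat -(card_ord (p + q)) -card_sets_lt.
Qed.
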